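(* For any Baire space $X$ and any compact space $Y$ the following conditions are equivalent: (i) every function $f:X\times Y\to\mathbb R$ which is quasi-continuous in the first variable and continuous in the second variable has the Namioka property; (ii) for every metrizable space $Z$, every mapping $f:X\times Y\to Z$ which is quasi-continuous in the first variable and continuous in the second variable has the Namioka property.
   Context: A topological space is Baire if every countable intersection of dense open subsets is dense. A mapping $g:X\to Z$ between topological spaces is quasi-continuous if for every $x_0\in X$, every neighborhood $U$ of $x_0$ and every neighborhood $V$ of $g(x_0)$ there is a nonempty open in $X$ set $G\subseteq U$ with $g(G)\subseteq V$. A mapping $f:X\times Y\to Z$ is quasi-continuous in the first variable if $x\mapsto f(x,y)$ is quasi-continuous for each $y\in Y$, and continuous in the second variable if $y\mapsto f(x,y)$ is continuous for each $x\in X$. A mapping $f:X\times Y\to Z$ has the Namioka property if there exists a dense in $X$ $G_\delta$-set $A\subseteq X$ such that $f$ is jointly continuous at each point of $A\times Y$. *)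

(* Defs.v *)
From HB Require Import structures.
From mathcomp Require Import all_boot all_order all_algebra.
From mathcomp Require Import all_classical all_reals all_analysis.
From mathcomp Require Import borel_hierarchy.

Set Implicit Arguments.
Unset Strict Implicit.
Unset Printing Implicit Defensive.

Import Order.TTheory GRing.Theory Num.Theory.
Import numFieldNormedType.Exports.

Local Open Scope classical_set_scope.
Local Open Scope ring_scope.

Definition baire_space (X : topologicalType) : Prop :=
  forall F : nat -> set X,
    (forall n, open (F n) /\ dense (F n)) -> dense (\bigcap_n F n).

Definition is_metric (R : realType) (Z : Type) (d : Z -> Z -> R) : Prop :=
  [/\ forall x y, 0 <= d x y,
      forall x y, d x y = 0 <-> x = y,
      forall x y, d x y = d y x
    & forall x y z, d x z <= d x y + d y z].

(* [nbhs_ball_] is the neighborhood system of a family of balls, so the last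
   equation says that the given topology of Z is the one induced by d. *)
Definition metrizable (R : realType) (Z : topologicalType) : Prop :=
  exists2 d : Z -> Z -> R, is_metric d
    & forall z : Z, nbhs z = nbhs_ball_ (fun x e => [set y | d x y < e]) z.

Definition quasi_continuous (X Z : topologicalType) (g : X -> Z) : Prop :=
  forall (x0 : X) (U : set X) (V : set Z), nbhs x0 U -> nbhs (g x0) V ->
    exists G : set X, [/\ open G, G !=set0, G `<=` U & g @` G `<=` V].

Definition quasi_continuous_fst (X Y Z : topologicalType)
    (f : X * Y -> Z) : Prop :=
  forall y : Y, quasi_continuous (fun x : X => f (x, y)).

Definition continuous_snd (X Y Z : topologicalType) (f : X * Y -> Z) : Prop :=
  forall x : X, continuous (fun y : Y => f (x, y)).

Definition namioka_property (X Y Z : topologicalType)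
    (f : X * Y -> Z) : Prop :=
  exists A : set X, [/\ dense A, Gdelta A
    & forall (x : X) (y : Y), A x -> {for (x, y), continuous f}].

(* Main.v *)
Require Import Defs.
From HB Require Import structures.
From mathcomp Require Import all_boot all_order all_algebra.
From mathcomp Require Import all_classical all_reals all_analysis.
From mathcomp Require Import borel_hierarchy.
From mathcomp Require Import lra.

Set Implicit Arguments.
Unset Strict Implicit.
Unset Printing Implicit Defensive.

Import Order.TTheory GRing.Theory Num.Theory.
Import numFieldNormedType.Exports.

Local Open Scope classical_set_scope.
Local Open Scope ring_scope.

(** Real-valued test functions suffice for an arbitrary metric space Z because
    the distances d a (f (x, y)) from finitely many well chosen points a already
    control f.

    Since Y is compact, joint continuity of f along a whole fibre {x} * Y is
    uniform in y, so that (X being Baire) the Namioka property amounts to the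
    following: for every e > 0, each nonempty open subset of X contains a
    nonempty open W on which d (f (x, y)) (f (x', y)) < e for all x, x' in W and
    all y.  The two directions are [densely_small_of_namioka] and
    [namioka_of_densely_small].

    Let U be nonempty open in X.  Every compact set f (x, Y) is covered by
    finitely many e-balls, and by the Baire property some bound n on their number
    holds for all x in a dense subset of some nonempty open W0 inside U.  Now
    choose anchors a_1, a_2, ... in Z greedily.  Given a_1, ..., a_m and a
    nonempty open W inside W0, suppose that some value f (x0, y0) with x0 in W is
    at distance at least 4e from all of them; take it as a_(m+1), and by
    quasi-continuity of f (-, y0) shrink W so that f (x, y0) stays e-close to
    a_(m+1) for every x in W.  All anchors are then e-close to f (x, Y) for every
    x in W, and they are 4e-separated, so covering f (x, Y) by e-balls takes at
    least as many balls as there are anchors.  Hence the process stops with at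
    most n anchors.

    When it stops, every f (x, y) with x in W lies within 4e of an anchor.  The
    real functions d a_i (f (x, y)) inherit quasi-continuity in x and continuity
    in y, so by hypothesis they have the Namioka property, and W can be shrunk
    until each of them varies by less than e in x, uniformly in y.  If f (x, y)
    is within 4e of a_i, then f (x', y) is within 5e of a_i, and f varies by less
    than 9e ([densely_small_of_distances]).  The converse implication holds since
    R is itself metrizable. *)

(** * Metrics and small variation in the first variable *)

(** The data of [metrizable], kept as a predicate on the metric so that the same
    lemmas serve both Z and R. *)
Definition compatible_metric (R : realType) (Z : topologicalType)
    (d : Z -> Z -> R) : Prop :=
  is_metric d /\
  forall z : Z, nbhs z = nbhs_ball_ (fun x e => [set y | d x y < e]) z.

Definition nonempty_open (X : topologicalType) (U : set X) : Prop :=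
  open U /\ U !=set0.

Definition small_on (R : realType) (X Y Z : Type) (d : Z -> Z -> R)
    (f : X * Y -> Z) (e : R) (W : set X) : Prop :=
  forall x x' y, W x -> W x' -> d (f (x, y)) (f (x', y)) < e.

Definition densely_small (R : realType) (X : topologicalType) (Y Z : Type)
    (d : Z -> Z -> R) (f : X * Y -> Z) (e : R) : Prop :=
  forall U, nonempty_open U ->
    exists W, [/\ nonempty_open W, W `<=` U & small_on d f e W].

Lemma nbhs_metric_ball (R : realType) (Z : topologicalType) (d : Z -> Z -> R)
    (dZ : compatible_metric d) (z : Z) (e : R) :
  0 < e -> nbhs z [set y | d z y < e].
Proof. by move=> e0; rewrite dZ.2; exists e. Qed.

Lemma dist_compatible (R : realType) :
  compatible_metric (fun x y : R => `|x - y|).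
Proof.
split; last by move=> z; rewrite -[in LHS]nbhs_ballE.
split=> [x y|x y|x y|x y z]; first exact: normr_ge0.
- split=> [/eqP|->]; last by rewrite subrr normr0.
  by rewrite normr_eq0 subr_eq0 => /eqP.
- exact: distrC.
- exact: ler_distD.
Qed.

Lemma continuous_dist_from (R : realType) (Z : topologicalType)
    (d : Z -> Z -> R) (dZ : compatible_metric d) (a : Z) :
  continuous (d a).
Proof.
have [d0 dE dC dT] := dZ.1.
move=> z V; rewrite -[nbhs _ V]/(nbhs (d a z) V) -nbhs_ballE => -[e /= e0 eV].
apply: filterS (nbhs_metric_ball dZ z e0) => t /= zt; apply: eV => /=.
rewrite -ball_normE /= ltr_norml.
have := dT a z t; have := dT a t z; rewrite (dC t z).
by move=> h1 h2; apply/andP; split; lra.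
Qed.

Lemma quasi_continuous_comp (X Z T : topologicalType) (g : X -> Z)
    (h : Z -> T) :
  quasi_continuous g -> continuous h -> quasi_continuous (h \o g).
Proof.
move=> qg ch x U V xU /ch hV; have [G [oG G0 GU GV]] := qg x U _ xU hV.
by exists G; split=> // _ [t Gt <-]; apply: GV; exists t.
Qed.

(** * The Namioka property as densely small variation *)

(** Compactness of Y turns the neighborhoods of the points (x, y), for a fixed
    point x of joint continuity, into one neighborhood of x valid for all y. *)
Lemma densely_small_of_namioka (R : realType) (X Y Z : topologicalType)
    (compactY : compact [set: Y]) (d : Z -> Z -> R)
    (dZ : compatible_metric d) (f : X * Y -> Z) :
  namioka_property f ->
  forall e : R, 0 < e -> densely_small d f e.
Proof.
have [d0 dE dC dT] := dZ.1.
case=> A [dA _ cA] e e0 U [oU U0].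
have [x [Ux Ax]] := dA U U0 oU.
have e40 : 0 < e / 4 by lra.
have near_x : \forall x' \near x,
    [set: Y] `<=` [set y | d (f (x, y)) (f (x', y)) < e / 2].
  move/compact_near_coveringP: compactY; apply.
  move=> y _; have := cA x y Ax _ (nbhs_metric_ball dZ (f (x, y)) e40).
  case=> -[V W] /= [xV yW] VW; exists (W, V) => //= -[y' x'] /= [Wy' Vx'].
  have /= h1 := VW (x', y') (conj Vx' Wy').
  (* The rectangle V * W also contains (x, y'), which bounds the change from
     f (x, y') to f (x, y). *)
  have /= h2 := VW (x, y') (conj (nbhs_singleton xV) Wy').
  have := dT (f (x, y')) (f (x, y)) (f (x', y')).
  by rewrite (dC _ (f (x, y))); lra.
pose N := [set x' | [set: Y] `<=` [set y | d (f (x, y)) (f (x', y)) < e / 2]].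
exists (U `&` N°); split; [split| |].
- by apply: openI => //; exact: open_interior.
- by exists x; split.
- by move=> ? [].
- move=> x1 x2 y [_ /interior_subset/(_ y I) /= h1].
  move=> [_ /interior_subset/(_ y I) /= h2].
  have := dT (f (x1, y)) (f (x, y)) (f (x2, y)).
  by rewrite (dC _ (f (x, y))); lra.
Qed.

(** At a point x having, for each n, a neighborhood on which f varies by less
    than 1/(n+1) uniformly in y, continuity of f (x, -) gives joint continuity.
    Such points form a countable intersection of dense open sets. *)
Lemma namioka_of_densely_small (R : realType) (X Y Z : topologicalType)
    (baireX : baire_space X) (d : Z -> Z -> R) (dZ : compatible_metric d)
    (f : X * Y -> Z) (cf : continuous_snd f) :
  (forall e : R, 0 < e -> densely_small d f e) ->
  namioka_property f.
Proof.
have [d0 dE dC dT] := dZ.1.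
move=> sf.
pose O n := \bigcup_(W in [set W | open W /\ small_on d f n.+1%:R^-1 W]) W.
have oO n : open (O n) by apply: bigcup_open => W [].
have dO n : dense (O n).
  move=> U U0 oU; have e0 : 0 < n.+1%:R^-1 :> R by rewrite invr_gt0 ltr0n.
  have [W [[oW [x Wx]] WU sW]] := sf _ e0 U (conj oU U0).
  by exists x; split; [exact: WU|exists W].
exists (\bigcap_n O n); split.
- by apply: baireX => n; split.
- by exists O.
- move=> x y Ax V; rewrite -[nbhs _ V]/(nbhs (f (x, y)) V) dZ.2.
  case=> e /= e0 eV; have e20 : 0 < e / 2 by lra.
  have [n _ ne] : \forall n \near \oo, (n.+1%:R^-1 : R) < e / 2.
    exact: near_infty_natSinv_lt (PosNum e20).
  have {}ne : n.+1%:R^-1 < e / 2 := ne n (leqnn n).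
  have [W [oW sW] Wx] := Ax n I.
  have xW : nbhs x W by exact: open_nbhs_nbhs.
  have yV := cf x y _ (nbhs_metric_ball dZ (f (x, y)) e20).
  exists (W, [set y' | d (f (x, y)) (f (x, y')) < e / 2]) => //=.
  move=> -[x' y'] /= [Wx' h1]; apply: eV => /=.
  have := dT (f (x, y)) (f (x, y')) (f (x', y')).
  by have := lt_trans (sW x x' y' Wx Wx') ne; lra.
Qed.

(** * Finite nets and separated points *)

(** If no such n and W exist, every U `&` B n is nowhere dense, and the
    complements of their closures have a common point in U, which lies in no
    B n. *)
Lemma baire_cover (X : topologicalType) (baireX : baire_space X)
    (B : nat -> set X) (U : set X) :
  nonempty_open U -> U `<=` \bigcup_n B n ->
  exists n W, [/\ nonempty_open W, W `<=` U
    & forall V, nonempty_open V -> V `<=` W -> V `&` B n !=set0].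
Proof.
move=> [oU U0] UB; apply: contrapT => nowhere.
have dO n : dense (~` (U `&` B n))°.
  move=> V V0 oV; apply: contrapT => VO.
  have [VU0|VU0] := pselect (V `&` U !=set0); last first.
    case: V0 => x Vx; apply: VO; exists x; split => //.
    apply: (filterS _ (open_nbhs_nbhs (conj oV Vx))) => t Vt [Ut _].
    by apply: VU0; exists t.
  apply: nowhere; exists n, (V `&` U); split=> [| |G [oG [x Gx]] GVU].
  - by split => //; exact: openI.
  - by move=> ? [].
  apply: contrapT => GB; apply: VO; exists x.
  split; first by have [] := GVU x Gx.
  apply: (filterS _ (open_nbhs_nbhs (conj oG Gx))) => t Gt [_ Bt].
  by apply: GB; exists t.
have := baireX (fun n => (~` (U `&` B n))°)
  (fun n => conj (open_interior _) (dO n)) U U0 oU.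
case=> x [Ux Ox]; have [n _ Bx] := UB x Ux.
by have /interior_subset := Ox n I; apply.
Qed.

Lemma compact_finite_net (R : realType) (Y Z : topologicalType)
    (compactY : compact [set: Y]) (d : Z -> Z -> R)
    (dZ : compatible_metric d) (g : Y -> Z) (e : R) :
  continuous g -> 0 < e ->
  exists c : seq Z, forall y, exists2 z, z \in c & d z (g y) < e.
Proof.
move=> cg e0.
(* Finite lists, ordered by inclusion of their elements, are directed: a
   property that holds, near each point of Y, for all lists containing a given
   one, holds on the compact space Y for a single list. *)
pose F : set_system (seq Z) :=
  fun P => exists c0 : seq Z, forall c, {subset c0 <= c} -> P c.
have FF : Filter F.
  split=> [|P Q [p Pp] [q Qq]|P Q PQ [p Pp]]; first by exists [::].
    exists (p ++ q) => c pqc; split; [apply: Pp|apply: Qq] => z zc;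
      by apply: pqc; rewrite mem_cat zc ?orbT.
  by exists p => c /Pp /PQ.
have [|c0 /(_ c0) Fc0] := (compact_near_coveringP _).1 compactY (seq Z) F
    (fun c y => exists2 z, z \in c & d z (g y) < e) FF.
  move=> y _; have yV := cg y _ (nbhs_metric_ball dZ (g y) e0).
  exists ([set y' | d (g y) (g y') < e], [set c | g y \in c]).
    by split=> //; exists [:: g y] => c; apply; rewrite mem_head.
  by move=> [y' c] /= [h1 h2]; exists (g y).
by exists c0 => y; apply: Fc0.
Qed.

(** A ball of radius e contains at most one point of a 2e-separated list. *)
Lemma separated_size_le (R : realType) (Z : choiceType) (d : Z -> Z -> R)
    (dm : is_metric d) (e : R) (s c : seq Z) :
  pairwise (fun a b => 2 * e <= d a b) s ->
  (forall a, a \in s -> exists2 z, z \in c & d z a < e) ->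
  (size s <= size c)%N.
Proof.
have [d0 dE dC dT] := dm.
elim: s c => //= a s IH c /andP[/allP sa ss] sc.
have [z zc za] := sc a (mem_head _ _).
rewrite (perm_size (perm_to_rem zc)) /= ltnS; apply: IH => // b bs.
have [w wc wb] := sc b (mem_behead (s := a :: s) bs).
exists w => //; move: wc; rewrite (perm_mem (perm_to_rem zc)) in_cons.
case/orP => // /eqP wz; have := sa b bs; have := dT a z b.
by rewrite -wz in za *; rewrite (dC a w); lra.
Qed.

(** * Controlling a map by distances to finitely many points *)

Lemma small_on_anchors (R : realType) (X Y Z : topologicalType)
    (d : Z -> Z -> R) (f : X * Y -> Z) (e : R)
    (sm : forall a : Z,
      densely_small (fun u v : R => `|u - v|) (fun p => d a (f p)) e)
    (s : seq Z) (U : set X) :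
  nonempty_open U -> exists W, [/\ nonempty_open W, W `<=` U
    & {in s, forall a, small_on (fun u v : R => `|u - v|)
                         (fun p => d a (f p)) e W}].
Proof.
elim: s U => [|a s IH] U neU; first by exists U; split.
have [V [neV VU aV]] := sm a U neU; have [W [neW WV sW]] := IH V neV.
exists W; split=> //; first exact: subset_trans VU.
move=> b; rewrite in_cons => /orP[/eqP->|bs]; last exact: sW.
by move=> x x' y Wx Wx'; apply: aV; apply: WV.
Qed.

(** The greedy choice of anchors.  The constants: the anchors are e-close to
    values of f and 4e-separated, so that balls of radius 2e around the centers
    of an e-net of f (x, Y) capture at most one anchor each; and
    9e = 4e (from f (x, y) to an anchor) + 5e (from that anchor to f (x', y)). *)
Lemma densely_small_of_distances (R : realType) (X Y Z : topologicalType)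
    (baireX : baire_space X) (compactY : compact [set: Y])
    (d : Z -> Z -> R) (dZ : compatible_metric d) (f : X * Y -> Z)
    (qf : quasi_continuous_fst f) (cf : continuous_snd f)
    (e : R) (e0 : 0 < e)
    (sm : forall a : Z,
      densely_small (fun u v : R => `|u - v|) (fun p => d a (f p)) e) :
  densely_small d f (9 * e).
Proof.
have [d0 dE dC dT] := dZ.1.
move=> U neU.
pose B n := [set x : X | exists2 c : seq Z, (size c <= n)%N &
  forall y, exists2 z, z \in c & d z (f (x, y)) < e].
have UB : U `<=` \bigcup_n B n.
  move=> x _; have [c xc] := compact_finite_net compactY dZ (cf x) e0.
  by exists (size c) => //; exists c.
have [n [W0 [neW0 W0U W0B]]] := baire_cover baireX neU UB.
apply: contrapT => notsmall.
(* As long as the anchors do not control f, another one can be added, at the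
   price of shrinking W. *)
have grow m : exists (s : seq Z) W, [/\ size s = m, nonempty_open W, W `<=` W0,
    pairwise (fun a b => 4 * e <= d a b) s
  & {in s, forall a, exists y, forall x, W x -> d a (f (x, y)) < e}].
  elim: m => [|m [s [W [size_s neW WW0 sep anch]]]].
    by exists [::], W0; split.
  have [x0 [y0 [Wx0 far]]] : exists x0 y0,
      W x0 /\ {in s, forall a, 4 * e <= d (f (x0, y0)) a}.
    (* Otherwise every value of f over W is within 4e of an anchor in s. *)
    apply: contrapT => covered; apply: notsmall.
    have [V [neV VW osc]] := small_on_anchors sm s neW.
    exists V; split=> //; first by move=> t /VW /WW0 /W0U.
    move=> x x' y Vx Vx'.
    have [a sa ax] : exists2 a, a \in s & d a (f (x, y)) < 4 * e.
      apply: contrapT => noa; apply: covered; exists x, y.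
      split; first exact: VW.
      move=> a sa; rewrite leNgt; apply/negP => near_a.
      apply: noa; exists a => //.
      by rewrite dC.
    have := osc a sa x x' y Vx Vx'; rewrite ltr_norml => /andP[lo hi].
    by have := dT (f (x, y)) a (f (x', y)); rewrite (dC _ a); lra.
  have [oW _] := neW.
  have [G [oG G0 GW GV]] := qf y0 x0 W _ (open_nbhs_nbhs (conj oW Wx0))
    (nbhs_metric_ball dZ (f (x0, y0)) e0).
  exists (f (x0, y0) :: s), G; split=> //=.
  - by rewrite size_s.
  - exact: subset_trans WW0.
  - by rewrite sep andbT; apply/allP => a /far.
  - move=> a; rewrite in_cons => /orP[/eqP->|/anch[y ay]].
      by exists y0 => x Gx; apply: GV; exists x.
    by exists y => x /GW /ay.
(* W meets B n, where n balls suffice, so n + 1 anchors are too many. *)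
have [s [W [ss neW WW0 sep anch]]] := grow n.+1.
have [x [Wx [c cn xc]]] := W0B W neW WW0.
suff : (size s <= size c)%N by rewrite ss leqNgt ltnS cn.
have {}sep : pairwise (fun a b => 2 * (2 * e) <= d a b) s.
  by apply: sub_pairwise sep => a b; lra.
apply: (separated_size_le dZ.1 sep) => a /anch[y ay].
have [z zc zy] := xc y; exists z => //.
by have := ay x Wx; have := dT z (f (x, y)) a; rewrite (dC (f _) a); lra.
Qed.

Theorem theorem5p2 (R : realType) (X Y : topologicalType)
    (baireX : baire_space X) (compactY : compact [set: Y]) :
  (forall f : X * Y -> R,
      quasi_continuous_fst f -> continuous_snd f -> namioka_property f)
  <->
  (forall Z : topologicalType, metrizable R Z ->
    forall f : X * Y -> Z,
      quasi_continuous_fst f -> continuous_snd f -> namioka_property f).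
Proof.
split=> [namR Z [d dm dnbhs] f qf cf|namZ]; last first.
  apply: namZ; have [dm dnbhs] := dist_compatible R.
  by exists (fun u v => `|u - v|).
have dZ : compatible_metric d by [].
apply: (namioka_of_densely_small baireX dZ cf) => e e0 U neU.
have e90 : 0 < e / 9 by lra.
have [a|W [neW WU sW]] :=
    densely_small_of_distances baireX compactY dZ qf cf e90 _ neU; last first.
  exists W; split=> // x x' y Wx Wx'.
  by have := sW x x' y Wx Wx'; lra.
have ca : continuous (d a) by exact: continuous_dist_from.
apply: (densely_small_of_namioka compactY (dist_compatible R)) => //.
apply: namR.
  by move=> y; exact: quasi_continuous_comp (qf y) ca.
by move=> x y; apply: continuous_comp; [exact: cf|exact: ca].
Qed.
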